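(* Let $N,T\ge 1$ be integers and let $\alpha\in(0,1)$ be such that $\alpha T$ is an integer. Suppose the base station uses the uniformly random scheduling algorithm, and let $\Delta(\sigma)=\frac1T\sum_{t=1}^T\frac1N\sum_{i=1}^N\Delta_i(t)$ be the resulting average age under the blocking matrix $\sigma$. Then for every user $i\in\{1,\dots,N\}$ there is a set of $\alpha T$ consecutive time slots in $\{1,\dots,T\}$ such that the blocking matrix $\sigma$ which blocks user $i$ exactly in these slots and blocks no other user at any time maximizes $\Delta(\sigma)$ over all feasible blocking matrices.
   Context: A base station serves $N$ users over time slots $1,\dots,T$. A blocking matrix is $\sigma\in\{0,1\}^{N\times T}$, chosen by an adversary in advance; $\sigma_i(t)=0$ means user $i$ is blocked in slot $t$, and $\sigma_i(t)=1$ means it is not. It is feasible if $\sum_{i=1}^N\sum_{t=1}^T(1-\sigma_i(t))\le\alpha T$ and $\sum_{i=1}^N(1-\sigma_i(t))\le 1$ for each $t$. Uniformly random scheduling algorithm: in each slot $t$, independently of everything else, the base station chooses one user uniformly at random (each with probability $1/N$). Age process: $a_i(1)=1$; $a_i(t+1)=1$ if user $i$ is chosen in slot $t$ and $\sigma_i(t)=1$; otherwise $a_i(t+1)=a_i(t)+1$. Index-shift convention: the average age attributed to slot $t$ is the expected age resulting from the actions in slots $1,\dots,t$, i.e. $\Delta_i(t):=\mathbb{E}[a_i(t+1)]$ for $t=1,\dots,T$. *)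

(* Defs.v *)
From HB Require Import structures.
From mathcomp Require Import all_boot all_order all_algebra.
From mathcomp Require Import all_classical all_reals all_analysis.

Set Implicit Arguments.
Unset Strict Implicit.
Unset Printing Implicit Defensive.

Import Order.TTheory GRing.Theory Num.Theory.

Local Open Scope classical_set_scope.
Local Open Scope ring_scope.

(* Users are numbered from 0, and the slots 1, ..., T are numbered
   0, ..., T - 1: the ordinal t : 'I_T stands for the slot t + 1.  A blocking
   matrix is an element of 'M[bool]_(N, T); sigma i t = false means that user i
   is blocked in slot t. *)

Definition feasible (R : realType) (N T : nat) (alpha : R)
    (sigma : 'M[bool]_(N, T)) : Prop :=
  (\sum_(i < N) \sum_(t < T) (1 - sigma i t))%N%:R <= alpha * T%:R /\
  forall t : 'I_T, (\sum_(i < N) (1 - sigma i t) <= 1)%N.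

Definition block_run (N T : nat) (i : 'I_N) (s m : nat) : 'M[bool]_(N, T) :=
  \matrix_(j < N, t < T) ~~ [&& j == i, (s <= t)%N & (t < s + m)%N].

(* age sigma c i n is the age of user i after the actions of the first n slots,
   i.e. a_i(n + 1), when c t is the user chosen in slot t. *)
Fixpoint age (N T : nat) (sigma : 'M[bool]_(N, T)) (c : 'I_T -> 'I_N)
    (i : 'I_N) (n : nat) : nat :=
  if n is n'.+1 then
    if [exists t : 'I_T, [&& t == n' :> nat, c t == i & sigma i t]] then 1%N
    else (age sigma c i n').+1
  else 1%N.

Lemma ageS (N T : nat) (sigma : 'M[bool]_(N, T)) (c : 'I_T -> 'I_N)
    (i : 'I_N) (t : 'I_T) :
  age sigma c i t.+1 =
  if (c t == i) && sigma i t then 1%N else (age sigma c i t).+1.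
Proof.
rewrite /=; congr (if _ then _ else _).
apply/existsP/idP => [[t' /and3P[/eqP /val_inj -> -> ->]] //|/andP[ct st]].
by exists t; rewrite eqxx ct st.
Qed.

Definition mutually_independent (R : realType) (d : measure_display)
    (Omega : measurableType d) (P : probability Omega R) (I S : finType)
    (X : I -> Omega -> S) : Prop :=
  forall (J : {set I}) (A : I -> set S),
    P (\bigcap_(t in [set t | t \in J]) (X t @^-1` A t)) =
    (\prod_(t in J) P (X t @^-1` A t))%E.

(* u t w is the user chosen in slot t under the outcome w. *)
Definition uniformly_random_scheduling (R : realType) (d : measure_display)
    (Omega : measurableType d) (P : probability Omega R) (N T : nat)
    (u : 'I_T -> Omega -> 'I_N) : Prop :=
  [/\ forall t i, measurable (u t @^-1` [set i]),
      forall t i, P (u t @^-1` [set i]) = (N%:R^-1)%:E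
    & mutually_independent P u].

(* With slots numbered from 0, the age attributed to slot t is the one after
   the first t.+1 slots. *)
Definition expected_age (R : realType) (d : measure_display)
    (Omega : measurableType d) (P : probability Omega R) (N T : nat)
    (u : 'I_T -> Omega -> 'I_N) (sigma : 'M[bool]_(N, T))
    (i : 'I_N) (t : 'I_T) : \bar R :=
  ('E_P[fun w => (age sigma (u^~ w) i t.+1)%:R])%E.

Definition average_age (R : realType) (d : measure_display)
    (Omega : measurableType d) (P : probability Omega R) (N T : nat)
    (u : 'I_T -> Omega -> 'I_N) (sigma : 'M[bool]_(N, T)) : \bar R :=
  ((T%:R^-1)%:E * \sum_(t < T) ((N%:R^-1)%:E *
     \sum_(i < N) expected_age P u sigma i t))%E.

(* Main.v *)
(* A user's age after n slots is the number of a <= n such that no update occurs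
   in the slots of [a, n). With q = 1 - 1/N, its expectation is therefore the sum
   over a of q ^ U[a, n), where U counts unblocked slots, and the average age is,
   up to a constant factor, a sum over users and intervals of q ^ U.
   Each term is a supermodular and increasing function of the set of blocked
   slots; as distinct users are blocked in disjoint sets, moving all the blocking
   to one user and then completing it to exactly m slots does not decrease the
   sum.
   For a single user, let v(c) be the number of unblocked slots before the cut
   point c. The sum over intervals is, up to constants, half the sum of
   q ^ |v(a) - v(b)| over all pairs of cut points. The values of v are 0, ..., T - m
   once each, plus m repeated values, one per blocked slot. The interaction of
   the repeated values with 0, ..., T - m is largest when each sits at a maximizer
   of a fixed function, and their mutual interaction is largest when they all
   coincide: both hold for one run of consecutive blocked slots. *)
Require Import Defs.
From HB Require Import structures.
From mathcomp Require Import all_boot all_order all_algebra.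
From mathcomp Require Import all_classical all_reals all_analysis measurable_realfun.
From mathcomp Require Import zify ring.

Set Implicit Arguments.
Unset Strict Implicit.
Unset Printing Implicit Defensive.

Import Order.TTheory GRing.Theory Num.Theory.

Local Open Scope ring_scope.

(** * Counting the unblocked slots before a cut point *)

Definition unblocked (w : pred nat) (n : nat) : nat := (\sum_(0 <= t < n) ~~ w t)%N.

Lemma unblockedS (w : pred nat) (n : nat) : unblocked w n.+1 = (unblocked w n + ~~ w n)%N.
Proof. by rewrite /unblocked big_nat_recr. Qed.

Lemma unblockedB (w : pred nat) (a b : nat) : (a <= b)%N ->
  (unblocked w b - unblocked w a = \sum_(a <= t < b) ~~ w t)%N.
Proof. by move=> ab; rewrite /unblocked (big_cat_nat (n := a)) //= addKn. Qed.

Lemma unblocked_le (w : pred nat) (a b : nat) : (a <= b)%N ->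
  (unblocked w a <= unblocked w b)%N.
Proof. by move=> ab; rewrite /unblocked (big_cat_nat (n := a) (p := b)) //= leq_addr. Qed.

Lemma iota0S n : iota 0 n.+1 = rcons (iota 0 n) n.
Proof. by rewrite -addn1 iotaD cats1. Qed.

Lemma unblocked_count (w : pred nat) (n : nat) :
  (unblocked w n + count w (iota 0 n) = n)%N.
Proof.
elim: n => [|n IHn]; first by rewrite /unblocked big_geq.
by rewrite unblockedS iota0S -cats1 count_cat /=; move: IHn; case: (w n) => /=; lia.
Qed.

Lemma sum_unblockedB (w : pred nat) (a b : nat) :
  (\sum_(a <= t < b) ~~ w t = (b - a) - \sum_(a <= t < b) w t)%N.
Proof.
suff -> : (b - a = \sum_(a <= t < b) ~~ w t + \sum_(a <= t < b) w t)%N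
  by rewrite addnK.
rewrite -big_split /= -[LHS]muln1 -sum_nat_const_nat.
by apply: eq_bigr => t _; case: (w t).
Qed.

(* Each blocked slot repeats a value, each unblocked one adds a new value. *)
Lemma perm_unblocked (w : pred nat) (n : nat) :
  perm_eq [seq unblocked w c | c <- iota 0 n.+1]
    (iota 0 (unblocked w n).+1 ++ [seq unblocked w t | t <- iota 0 n & w t]).
Proof.
elim: n => [|n IHn]; first by rewrite /= /unblocked big_geq.
rewrite (iota0S n.+1) map_rcons [in X in perm_eq _ X](iota0S n) filter_rcons -cats1.
apply: (perm_trans (y := (iota 0 (unblocked w n).+1 ++
  [seq unblocked w t | t <- iota 0 n & w t]) ++ [:: unblocked w n.+1])).
  by rewrite perm_cat2r.
rewrite unblockedS; case: ifP => wn.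
  by rewrite addn0 map_rcons -cats1 catA.
by rewrite addn1 [iota 0 (_.+2)]iota0S -cats1 -!catA perm_cat2l perm_catC.
Qed.

(** Induction on the deficit: as long as fewer than [m] slots below [T] are blocked, one of them is
    free and can be blocked too. *)
Lemma extend_count (w : pred nat) (T m : nat) :
  (count w (iota 0 T) <= m <= T)%N ->
  exists2 w' : pred nat, (forall t, w t -> w' t) & count w' (iota 0 T) = m.
Proof.
move=> /andP[wm mT]; have [k] := ubnP (m - count w (iota 0 T)).
elim: k w wm => [|k IHk] w wm mk //.
case: (eqVneq (count w (iota 0 T)) m) => [|wneq]; first by exists w.
have /allPn[t tT wt] : ~~ all w (iota 0 T).
  by apply: contra wneq; rewrite all_count size_iota => /eqP wT; rewrite eqn_leq wm wT mT.
have wtT : count [pred x | w x || (x == t)] (iota 0 T) = (count w (iota 0 T)).+1.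
  have := count_predUI w (pred1 t) (iota 0 T).
  rewrite (count_uniq_mem t (iota_uniq 0 T)) tT addn1 => <-.
  rewrite [X in _ = (_ + X)%N](@eq_count _ _ pred0) ?count_pred0 ?addn0 //.
  by move=> x /=; case: eqP => [->|]; rewrite ?andbF ?(negbTE wt).
have [] := IHk [pred x | w x || (x == t)].
- by rewrite wtT ltn_neqAle wneq.
- by rewrite wtT; lia.
by move=> w' ww' w'm; exists w' => // x wx; apply: ww'; rewrite /= wx.
Qed.

(** * Runs of consecutive blocked slots *)

Definition run (s m : nat) : pred nat := fun t => (s <= t)%N && (t < s + m)%N.

Lemma count_run s m T : (s + m <= T)%N -> count (run s m) (iota 0 T) = m.
Proof.
move=> smT.
have -> : T = (s + (m + (T - s - m)))%N by lia.
rewrite !iotaD !count_cat add0n.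
rewrite (@eq_in_count _ _ pred0) ?count_pred0; last first.
  by move=> t; rewrite mem_iota /run /=; lia.
rewrite (@eq_in_count _ _ predT) ?count_predT ?size_iota; last first.
  by move=> t; rewrite mem_iota /run /=; lia.
rewrite (@eq_in_count _ _ pred0) ?count_pred0; last first.
  by move=> t; rewrite mem_iota /run /=; lia.
by rewrite addn0.
Qed.

Lemma unblocked_run s m t : run s m t -> unblocked (run s m) t = s.
Proof.
move=> /andP[st tsm].
have := unblocked_count (run s m) t.
suff -> : count (run s m) (iota 0 t) = (t - s)%N by lia.
rewrite -{1}(subnKC st) iotaD count_cat add0n.
rewrite (@eq_in_count _ _ pred0) ?count_pred0; last first.
  by move=> x; rewrite mem_iota /run /=; lia.
rewrite (@eq_in_count _ _ predT) ?count_predT ?size_iota //.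
by move=> x; rewrite mem_iota /run /=; lia.
Qed.

(** * Total age as a sum over pairs of cut points *)

Section Decay.
Variables (R : realFieldType) (q : R).

(* [x - y + (y - x)] is |x - y|: the subtractions are truncated. *)
Definition decay (x y : nat) : R := q ^+ ((x - y) + (y - x)).

(* [w t] means that slot t is blocked for the user. The term of (t, a) is the
   probability of no update in the slots of [a, t + 1). *)
Definition total_age (T : nat) (w : pred nat) : R :=
  \sum_(0 <= t < T) \sum_(0 <= a < t.+2) q ^+ (unblocked w t.+1 - unblocked w a).

Lemma decayC x y : decay x y = decay y x.
Proof. by rewrite /decay addnC. Qed.

Lemma decay_diag x : decay x x = 1.
Proof. by rewrite /decay subnn. Qed.

(** Doubling the triangle covers the square by symmetry, but counts the diagonal twice; its entries
    are 1, whence the extra [n]. *)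
Lemma triangular_sum (f : nat -> nat -> R) (n : nat) :
  (forall x y, f x y = f y x) -> (forall x, f x x = 1) ->
  (\sum_(0 <= b < n) \sum_(0 <= a < b.+1) f b a) *+ 2 =
  \sum_(0 <= b < n) \sum_(0 <= a < n) f b a + n%:R.
Proof.
move=> fC f1; elim: n => [|n IHn]; first by rewrite !big_geq // mul0rn addr0.
rewrite !big_nat_recr //= mulrnDl IHn.
under [X in _ = X + _ + _]eq_bigr do rewrite big_nat_recr //=.
rewrite big_split /= f1.
under [X in _ = _ + X + _ + _]eq_bigr do rewrite fC.
rewrite -(natr1 n); ring.
Qed.

(** The added 1 is the pair of cut points (0, 0): [total_age] only has rows for the cut points 1,
    ..., T. *)
Lemma total_age_decay T w :
  (total_age T w + 1) *+ 2 =
  \sum_(x <- [seq unblocked w c | c <- iota 0 T.+1])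
     \sum_(y <- [seq unblocked w c | c <- iota 0 T.+1]) decay x y + T.+1%:R.
Proof.
rewrite -[iota 0 T.+1]/(index_iota 0 T.+1) big_map.
under [X in _ = X + _]eq_bigr do rewrite big_map.
have := triangular_sum (f := fun x y => decay (unblocked w x) (unblocked w y)) T.+1.
move=> <-; first last.
- by move=> x; exact: decay_diag.
- by move=> x y; exact: decayC.
congr (_ *+ 2).
rewrite [RHS]big_nat_recl // addrC.
congr (_ + _); first by rewrite big_nat1 decay_diag.
apply: eq_big_nat => t _; apply: eq_big_nat => a /andP[_ at1].
rewrite /decay; congr (_ ^+ _).
have := @unblocked_le w a t.+1 at1; lia.
Qed.

Lemma sum_decay_cat (s1 s2 : seq nat) :
  \sum_(x <- s1 ++ s2) \sum_(y <- s1 ++ s2) decay x y =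
  \sum_(x <- s1) \sum_(y <- s1) decay x y
  + (\sum_(x <- s2) \sum_(y <- s1) decay x y) *+ 2
  + \sum_(x <- s2) \sum_(y <- s2) decay x y.
Proof.
rewrite big_cat /=.
under eq_bigr do rewrite big_cat /=.
under [X in _ + X = _]eq_bigr do rewrite big_cat /=.
rewrite !big_split /= [X in _ + X + _ = _]exchange_big /=.
under [X in _ + X + _ = _]eq_bigr do under eq_bigr do rewrite decayC.
ring.
Qed.

Lemma total_age_perm T w :
  let s := [seq unblocked w t | t <- iota 0 T & w t] in
  let r := iota 0 (unblocked w T).+1 in
  (total_age T w + 1) *+ 2 =
  \sum_(x <- r) \sum_(y <- r) decay x y
  + (\sum_(x <- s) \sum_(y <- r) decay x y) *+ 2
  + \sum_(x <- s) \sum_(y <- s) decay x y + T.+1%:R.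
Proof.
move=> s r; rewrite total_age_decay -sum_decay_cat; congr (_ + _).
rewrite (perm_big _ (perm_unblocked w T)) /=; apply: eq_bigr => x _.
exact: perm_big (perm_unblocked w T).
Qed.

(** * Maximization: one user, then several users merged into one *)

Hypothesis q01 : 0 <= q <= 1.

Lemma decay_le1 x y : decay x y <= 1.
Proof. by case/andP: q01 => q0 q1; rewrite exprn_ile1. Qed.

(* In total_age_perm, only the sums involving the repeated values [s] depend on
   [w]; both are largest when all of them equal the value s that maximizes
   [\sum_(y <- r) decay s y]. *)
Lemma total_age_run_max T m : (m <= T)%N ->
  exists2 s, (s + m <= T)%N & forall w, count w (iota 0 T) = m ->
    total_age T w <= total_age T (run s m).
Proof.
move=> mT; set r := iota 0 (T - m).+1.
pose F x := \sum_(y <- r) decay x y.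
have [s sT Fs] : exists2 s, (s <= T - m)%N &
    forall x, (x <= T - m)%N -> F x <= F s.
  case: (@arg_maxP _ _ _ (ord0 : 'I_(T - m).+1) xpredT F) => // j _ jmax.
  exists (j : nat) => [|x xle]; first by rewrite -ltnS.
  by have := jmax (Ordinal (xle : (x < (T - m).+1)%N)) isT.
have smT : (s + m <= T)%N by lia.
exists s => // w wm.
have unblockedT w' : count w' (iota 0 T) = m -> unblocked w' T = (T - m)%N.
  by move=> w'm; have := unblocked_count w' T; rewrite w'm; lia.
(* Both predicates leave [T - m] slots unblocked, so [r] is the same on both sides and the terms
   without repeated values cancel. *)
rewrite -(lerD2r 1) -(ler_pMn2r (n := 2)) // !total_age_perm.
rewrite !unblockedT // ?count_run // -/r lerD2r.
set sw := map _ _; set sr := map _ _.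
have szw : size sw = m by rewrite size_map size_filter.
(* The count of unblocked slots stays at [s] throughout the run. *)
have -> : sr = nseq m s.
  have szr : size sr = m by rewrite size_map size_filter count_run.
  rewrite -szr; apply/all_pred1P/allP => x /mapP[t]; rewrite mem_filter => /andP[rt _] ->.
  by rewrite /= unblocked_run.
have sw_le x : x \in sw -> (x <= T - m)%N.
  by case/mapP=> t; rewrite mem_filter mem_iota => /and3P[_ _ tT] ->;
    rewrite -(unblockedT w) // unblocked_le // ltnW.
apply: lerD; last first.
  have sum_le1 (f : nat -> R) (l : seq nat) : (forall x, f x <= 1) ->
      \sum_(x <- l) f x <= (size l)%:R.
    by move=> f1; rewrite -sum1_size natr_sum; apply: ler_sum => x _; exact: f1.
  rewrite !big_nseq !iter_addr_0 decay_diag.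
  rewrite -mulr_natl -szw; apply: le_trans (_ : _ <= \sum_(x <- sw) (size sw)%:R) _.
    by apply: ler_sum => x _; apply: sum_le1 => y; exact: decay_le1.
  by rewrite big_const_seq count_predT iter_addr_0 mulr_natl.
rewrite lerD2l ler_pMn2r // big_nseq iter_addr_0 -szw -/(F s) -[X in _ *+ X]sum1_size.
rewrite -mulr_natl natr_sum mulr_suml !big_seq; apply: ler_sum => x /sw_le xle.
by rewrite mul1r Fs.
Qed.

(* For two terms this is q ^ (n - b1 - b2) (1 - q ^ b1) (1 - q ^ b2) >= 0. *)
Lemma superadditive_pow (I : Type) (l : seq I) (b : I -> nat) (n : nat) :
  (\sum_(i <- l) b i <= n)%N ->
  \sum_(i <- l) (q ^+ (n - b i) - q ^+ n)
    <= q ^+ (n - \sum_(i <- l) b i) - q ^+ n.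
Proof.
case/andP: q01 => q0 q1.
elim: l => [|i l IHl]; first by rewrite !big_nil subn0 subrr.
rewrite !big_cons; set B := (\sum_(j <- l) b j)%N => le_n.
have {}IHl := IHl (leq_trans (leq_addl _ _) le_n).
apply: le_trans (lerD (lexx _) IHl) _.
have := subnK le_n; set k := (n - (b i + B))%N => defn.
have -> : (n - b i = k + B)%N by lia.
have -> : (n - B = k + b i)%N by lia.
rewrite -defn !exprD -subr_ge0.
have -> : q ^+ k - q ^+ k * (q ^+ b i * q ^+ B) -
  (q ^+ k * q ^+ B - q ^+ k * (q ^+ b i * q ^+ B) +
   (q ^+ k * q ^+ b i - q ^+ k * (q ^+ b i * q ^+ B)))
  = q ^+ k * ((1 - q ^+ b i) * (1 - q ^+ B)) by ring.
by rewrite !mulr_ge0 ?exprn_ge0 // subr_ge0 exprn_ile1.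
Qed.

(** Holds interval by interval: the blocked counts of the users add up to that of [W], which is at
    most the length, so [superadditive_pow] applies. *)
Lemma total_age_merge T (I : finType) (w : I -> pred nat) (W : pred nat) :
  (forall t, (t < T)%N -> \sum_i w i t = W t :> nat)%N ->
  \sum_i (total_age T (w i) - total_age T pred0)
    <= total_age T W - total_age T pred0.
Proof.
move=> wW; rewrite /total_age.
under eq_bigr do rewrite -sumrB.
rewrite exchange_big -sumrB; apply: ler_sum_nat => t /andP[_ tT].
under eq_bigr do rewrite -sumrB.
rewrite exchange_big -sumrB; apply: ler_sum_nat => a /andP[_ at2].
have unblocked0 n : unblocked pred0 n = n.
  by have := unblocked_count pred0 n; rewrite count_pred0 addn0.
rewrite !unblocked0 unblockedB // sum_unblockedB.
have sumW : (\sum_i \sum_(a <= x < t.+1) w i x = \sum_(a <= x < t.+1) W x)%N.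
  rewrite exchange_big; apply: eq_big_nat => x /andP[_ xt] /=.
  by apply: wW; apply: leq_trans tT.
rewrite -sumW; apply: le_trans (superadditive_pow _).
  by apply: ler_sum => i _; rewrite unblockedB // sum_unblockedB.
rewrite sumW -[(t.+1 - a)%N]muln1 -sum_nat_const_nat.
by apply: leq_sum => x _; exact: leq_b1.
Qed.

Lemma total_age_mono T (w w' : pred nat) : (forall t, w t -> w' t) ->
  total_age T w <= total_age T w'.
Proof.
case/andP: q01 => q0 q1 ww'.
apply: ler_sum_nat => t _; apply: ler_sum_nat => a /andP[_ at2].
rewrite !unblockedB //; apply: ler_wiXn2l => //.
by apply: leq_sum => x _; case: (w x) (ww' x) => [/(_ isT) ->|_] //; exact: leq_b1.
Qed.

(** Measuring gains over [pred0] makes users who are never blocked contribute 0, so a sum over all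
    users can be compared with a single run. *)
Lemma run_optimal T m : (m <= T)%N ->
  exists2 s, (s + m <= T)%N & forall (I : finType) (w : I -> pred nat),
    (forall t, (t < T)%N -> \sum_i w i t <= 1)%N ->
    (\sum_i count (w i) (iota 0 T) <= m)%N ->
    \sum_i (total_age T (w i) - total_age T pred0)
      <= total_age T (run s m) - total_age T pred0.
Proof.
move=> mT; have [s smT smax] := total_age_run_max mT.
(* [W] is the union of the users' blocked sets, disjoint below [T] by [w1]. *)
exists s => // I w w1 wm; pose W t := [exists i, w i t].
have wW t : (t < T)%N -> (\sum_i w i t = W t)%N.
  move=> tT; have := w1 t tT; rewrite /W; case: existsP => [[i wit]|nex] w1t.
    by apply/eqP; rewrite eqn_leq w1t (bigD1 i) //= wit.
  by rewrite big1 // => i _; case wit: (w i t) => //; case: nex; exists i.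
have Wm : (count W (iota 0 T) <= m)%N.
  apply: leq_trans wm; apply: eq_leq.
  under [RHS]eq_bigr do rewrite -sum1_count big_mkcond.
  rewrite exchange_big -sum1_count big_mkcond /=.
  apply: eq_big_seq => t; rewrite mem_iota => /wW wWt.
  transitivity (W t : nat); first by case: (W t).
  by rewrite -wWt; apply: eq_bigr => j _; case: (w j t).
have [|W' WW' W'm] := @extend_count W T m; first by rewrite Wm.
apply: le_trans (total_age_merge wW) _; rewrite lerD2r.
exact: le_trans (total_age_mono T WW') (smax _ W'm).
Qed.

End Decay.

(** * The age process and its expectation under random scheduling *)

Definition blocked (N T : nat) (sigma : 'M[bool]_(N, T)) (i : 'I_N) : pred nat :=
  fun t => [exists t' : 'I_T, (t' == t :> nat) && ~~ sigma i t'].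

Lemma blockedE (N T : nat) (sigma : 'M[bool]_(N, T)) (i : 'I_N) (t : 'I_T) :
  blocked sigma i t = ~~ sigma i t.
Proof.
apply/existsP/idP => [[t' /andP[/eqP /val_inj ->]] //|st].
by exists t; rewrite eqxx.
Qed.

(** An update in the last slot rules out every interval except the empty one, giving age 1;
    otherwise all earlier intervals survive and the empty one is new. *)
Lemma age_sum (N T : nat) (sigma : 'M[bool]_(N, T)) (c : 'I_T -> 'I_N)
    (i : 'I_N) (n : nat) : (n <= T)%N ->
  age sigma c i n = (\sum_(0 <= a < n.+1)
    [forall t : 'I_T, (a <= t < n) ==> ~~ ((c t == i) && sigma i t)])%N.
Proof.
elim: n => [|n IHn] nT.
  by rewrite big_nat1 /=; case: forallP => // -[] t; rewrite andbF.
have := ageS sigma c i (Ordinal nT) => /= ->.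
rewrite big_nat_recr //=.
have -> : [forall t : 'I_T, (n.+1 <= t < n.+1)%N ==>
    ~~ ((c t == i) && sigma i t)] = true.
  by apply/forallP => t; apply/implyP => /andP[]; lia.
rewrite addn1 (IHn (ltnW nT)); case: ifP => hit.
  rewrite big_nat_cond big1 // => a /andP[/andP[_ an] _].
  apply/eqP; rewrite eqb0; apply/forallPn; exists (Ordinal nT).
  by rewrite hit /= -ltnS an ltnSn.
congr _.+1; apply: eq_big_nat => a /andP[_ an]; congr (nat_of_bool _).
apply/forallP/forallP => nohit t; apply/implyP => /andP[at_ tn].
  have [tn'|] := ltnP t n; first by have /implyP := nohit t; apply; rewrite at_.
  move=> nt; have -> : t = Ordinal nT by apply/val_inj => /=; lia.
  by rewrite hit.
by have /implyP := nohit t; apply; rewrite at_ ltnW.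
Qed.

Section Expectation.
Context (R : realType) (d : measure_display) (Omega : measurableType d).
Variables (P : probability Omega R) (N T : nat) (u : 'I_T -> Omega -> 'I_N).
Hypothesis hu : uniformly_random_scheduling P u.
Local Open Scope classical_set_scope.

Let q : R := 1 - N%:R^-1.

(** The event splits into independent events, one per slot: an unblocked slot contributes the factor
    [q], a blocked one is no constraint. *)
Lemma no_update_prob (sigma : 'M[bool]_(N, T)) (i : 'I_N) (a n : nat) :
  (a <= n)%N -> (n <= T)%N ->
  let E := [set w | [forall t : 'I_T, (a <= t < n)%N ==>
                      ~~ ((u t w == i) && sigma i t)]] in
  measurable E /\
  P E = (q ^+ (unblocked (blocked sigma i) n - unblocked (blocked sigma i) a))%:E.
Proof.
move=> an nT E; have [mu Pu indep] := hu.
pose J := finset (fun t : 'I_T => (a <= t < n)%N).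
pose A (t : 'I_T) : set 'I_N := if sigma i t then ~` [set i] else setT.
have EE : E = \bigcap_(t in [set t | t \in J]) (u t @^-1` A t).
  apply/seteqP; split => w /=.
    move=> /forallP nohit t /=; rewrite inE => tJ.
    have /implyP /(_ tJ) := nohit t; rewrite /A /=.
    by case: (sigma i t); rewrite ?andbT ?andbF //= => /eqP.
  move=> nohit; apply/forallP => t; apply/implyP => tJ.
  have := nohit t; rewrite /= inE => /(_ tJ); rewrite /A.
  by case: (sigma i t); rewrite ?andbT ?andbF //= => /eqP.
have mA t : measurable (u t @^-1` A t).
  rewrite /A; case: (sigma i t); last by rewrite preimage_setT.
  by rewrite -preimage_setC; apply: measurableC.
split; first by rewrite EE; apply: fin_bigcap_measurable.
rewrite EE indep unblockedB //.
have PA t : P (u t @^-1` A t) = (q ^+ sigma i t)%:E.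
  rewrite /A; case: (sigma i t); last by rewrite preimage_setT probability_setT.
  by rewrite -preimage_setC probability_setC // Pu.
rewrite (eq_bigr (fun t => (q ^+ sigma i t)%:E)) => [|t _]; last exact: PA.
rewrite prodEFin; congr EFin.
rewrite prodrXr; congr (q ^+ _).
rewrite (big_nat_widen a n T xpredT) // (big_nat_widenl a 0) // big_mkord.
apply: eq_big => [t|t _]; first by rewrite inE /=; lia.
by rewrite blockedE negbK.
Qed.

Lemma expected_ageE (sigma : 'M[bool]_(N, T)) (i : 'I_N) (t : 'I_T) :
  expected_age P u sigma i t =
  (\sum_(0 <= a < t.+2) q ^+ (unblocked (blocked sigma i) t.+1
                              - unblocked (blocked sigma i) a))%:E.
Proof.
rewrite /expected_age unlock -sumEFin.
pose E a := [set w | [forall s : 'I_T, (a <= s < t.+1)%N ==>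
                      ~~ ((u s w == i) && sigma i s)]].
have mE a : (a < t.+2)%N -> measurable (E a).
  by move=> at2; have [] := no_update_prob sigma i (a := a) at2 (ltn_ord t).
(* The value 0 outside the range makes measurability and nonnegativity hold for every index [a], as
   [ge0_integral_sum] requires. *)
pose f a w : \bar R := if (a < t.+2)%N then (\1_(E a) w)%:E else 0%E.
transitivity (\int[P]_w (\sum_(0 <= a < t.+2) f a w))%E.
  apply: eq_integral => w _; rewrite age_sum // natr_sum -sumEFin.
  apply: eq_big_nat => a /andP[_ at2]; rewrite /f at2 indicE.
  have <- // : (w \in E a) = [forall s : 'I_T, (a <= s < t.+1)%N ==>
                               ~~ ((u s w == i) && sigma i s)].
  by apply/idP/idP; rewrite inE.
rewrite ge0_integral_sum //.
- apply: eq_big_nat => a /andP[_ at2]; rewrite /f at2 integral_indic ?setIT //; last exact: mE.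
  by have [] := no_update_prob sigma i (a := a) at2 (ltn_ord t).
- move=> a; rewrite /f; have [at2|_] := boolP (a < t.+2)%N => //.
  by apply/measurable_EFinP; apply: measurable_indic; exact: mE.
- by move=> a w _; rewrite /f; case: (a < t.+2)%N => //; rewrite lee_fin.
Qed.

Lemma average_ageE (sigma : 'M[bool]_(N, T)) :
  average_age P u sigma =
  (T%:R^-1 * N%:R^-1 * \sum_(i < N) total_age q T (blocked sigma i))%:E.
Proof.
rewrite /average_age; under eq_bigr do under eq_bigr do rewrite expected_ageE.
under eq_bigr do rewrite sumEFin -EFinM.
rewrite sumEFin -EFinM -mulrA; congr (_ * _)%:E.
rewrite -mulr_sumr exchange_big; congr (_ * _); apply: eq_bigr => i _.
by rewrite /total_age big_mkord.
Qed.

End Expectation.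

(** * Optimality among feasible blocking matrices *)

Theorem theorem1 (R : realType) (N T : nat) (hN : (1 <= N)%N) (hT : (1 <= T)%N)
    (alpha : R) (halpha : 0 < alpha < 1)
    (m : nat) (hm : alpha * T%:R = m%:R)
    (d : measure_display) (Omega : measurableType d) (P : probability Omega R)
    (u : 'I_T -> Omega -> 'I_N) (hu : uniformly_random_scheduling P u)
    (i : 'I_N) :
  exists2 s : nat, (s + m <= T)%N &
    feasible alpha (block_run T i s m) /\
    forall sigma : 'M[bool]_(N, T), feasible alpha sigma ->
      (average_age P u sigma <= average_age P u (block_run T i s m))%E.
Proof.
have mT : (m <= T)%N.
  rewrite -(ler_nat R) -hm ler_piMl //.
  by case/andP: halpha => _ /ltW.
pose q : R := 1 - N%:R^-1.
have q01 : 0 <= q <= 1.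
  have N0 : (0 : R) < N%:R by rewrite ltr0n.
  by rewrite subr_ge0 invf_le1 // ler1n hN gerBl invr_ge0 ltW.
have [s smT smax] := run_optimal q01 mT.
have countE (sigma : 'M[bool]_(N, T)) j :
    (\sum_(t < T) (1 - sigma j t) = count (blocked sigma j) (iota 0 T))%N.
  have -> : iota 0 T = index_iota 0 T by rewrite /index_iota subn0.
  rewrite -sum1_count [RHS]big_mkcond big_mkord.
  by apply: eq_bigr => t _; rewrite blockedE; case: (sigma j t).
have runE j t : (t < T)%N ->
    blocked (block_run T i s m) j t = (j == i) && run s m t.
  by move=> tT; rewrite (blockedE _ _ (Ordinal tT)) mxE negbK.
exists s => //; split.
  split.
    rewrite hm ler_nat; under eq_bigr do rewrite countE.
    rewrite (bigD1 i) //= big1 ?addn0 => [|j ji].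
      rewrite -[leqRHS](count_run smT); apply: eq_leq; apply: eq_in_count => t.
      by rewrite mem_iota => /runE ->; rewrite eqxx.
    rewrite (@eq_in_count _ _ pred0) ?count_pred0 // => t.
    by rewrite mem_iota => /runE ->; rewrite (negbTE ji).
  move=> t; rewrite (bigD1 i) //= big1 ?addn0 ?leq_subr // => j ji.
  by rewrite mxE (negbTE ji).
move=> sigma [sigma_m sigma1].
(* [runE] identifies the predicates only below [T], and [total_age] reads no slot beyond. *)
have age_ext (w w' : pred nat) : (forall t, (t < T)%N -> w t = w' t) ->
    total_age q T w = total_age q T w'.
  move=> ww'; apply: eq_big_nat => t /andP[_ tT]; apply: eq_big_nat => a /andP[_ at2].
  rewrite !unblockedB //; congr (_ ^+ _); apply: eq_big_nat => x /andP[_ xt].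
  by rewrite ww' // (leq_trans xt).
rewrite !(average_ageE hu) lee_fin ler_wpM2l //.
(* Passing to gains over no blocking; on the right only user [i] has a nonzero one. *)
rewrite -/q -(lerD2r (- \sum_(j < N) total_age q T pred0)) -!sumrB.
apply: le_trans (smax _ (blocked sigma) _ _) _.
- move=> t tT; apply: leq_trans (sigma1 (Ordinal tT)); apply: eq_leq.
  by apply: eq_bigr => j _; rewrite (blockedE _ _ (Ordinal tT)); case: (sigma _ _).
- under eq_bigr do rewrite -countE.
  by rewrite -(ler_nat R) -hm.
rewrite (bigD1 i) //= big1 ?addr0 => [|j ji].
  rewrite lerD2r (age_ext (blocked _ i) (run s m)) // => t /runE ->.
  by rewrite eqxx.
apply/eqP; rewrite subr_eq0; apply/eqP; apply: age_ext => t /runE ->.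
by rewrite (negbTE ji).
Qed.
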